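(* Let $q\ge 4$ be a prime power, let $n=m(2,q)$ (that is, $n=q+2$ if $q$ is even and $n=q+1$ if $q$ is odd), and let $\mathcal{C}\leqslant\mathbb{F}_q^n$ be an $[n,3,n-2]_q$ MDS code. Let $\mathbf{G}\in\mathbb{F}_q^{3\times n}$ be a generator matrix of $\mathcal{C}$ such that 1) $\min\{|R| : R\in\mathcal{R}_i(\mathbf{G})\text{ for some }i\in\{1,2,3\}\}=2$, and 2) for every $i\in\{1,2,3\}$, $\{R\in\mathcal{R}_i(\mathbf{G}) : |R|=2\}$ is a partition of $[n]=\{1,\dots,n\}$. Then the service rate region $\Lambda(\mathbf{G})$ is the standard simplex of edge size $n/2$, i.e. $\Lambda(\mathbf{G})=\Delta_3(n/2)$. Moreover, every point of $\Lambda(\mathbf{G})$ is supported by a feasible allocation $\{\lambda_{i,R} : i\in\{1,2,3\},\ R\in\mathcal{R}_i(\mathbf{G})\}$ such that $\lambda_{i,R}\ne 0$ if and only if $|R|=2$.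
   Context: An $[n,k,d]_q$ code is a $k$-dimensional linear subspace of $\mathbb{F}_q^n$ with minimum Hamming distance $d$; it is MDS if $d+k=n+1$. For $\mathbf{G}=(\mathbf{g}_1\mid\dots\mid\mathbf{g}_n)\in\mathbb{F}_q^{k\times n}$ with columns $\mathbf{g}_j$, and $i\in[k]$, a recovery set for the $i$-th object is a set $J\subseteq[n]$ such that $\mathbf{e}_i\in\langle\mathbf{g}_j : j\in J\rangle$, where $\mathbf{e}_i$ is the $i$-th standard basis vector of $\mathbb{F}_q^k$. A recovery set for the $i$-th object is minimal if it does not properly contain another recovery set for the $i$-th object. $\mathcal{R}_i(\mathbf{G})$ denotes the collection of minimal recovery sets for the $i$-th object. A vector $(\lambda_1,\dots,\lambda_k)\in\mathbb{R}^k$ is supported by $\mathbf{G}$ if there is a feasible allocation for it, i.e. real numbers $\{\lambda_{i,R} : i\in[k],\ R\in\mathcal{R}_i(\mathbf{G})\}$ with $\lambda_{i,R}\ge 0$ for all $i,R$; $\sum_{R\in\mathcal{R}_i(\mathbf{G})}\lambda_{i,R}=\lambda_i$ for all $i\in[k]$; and $\sum_{i=1}^k\sum_{R\in\mathcal{R}_i(\mathbf{G}),\, j\in R}\lambda_{i,R}\le 1$ for all $j\in[n]$. The service rate region $\Lambda(\mathbf{G})\subseteq\mathbb{R}^k$ is the set of all vectors supported by $\mathbf{G}$. For $s\ge 0$, the standard simplex of edge size $s$ in $\mathbb{R}^k$ is $\Delta_k(s)=\{(\lambda_1,\dots,\lambda_k)\in\mathbb{R}_{\ge0}^k : \sum_{i=1}^k\lambda_i\le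 s\}$.
   Formalization: The last equivalence is stated as: λ_{i,R} ≠ 0 if and only if |R| = 2 and λ_i ≠ 0, since when λ_i = 0 (e.g. at the origin) all λ_{i,R} must vanish although sets R with |R| = 2 exist. *)

(* Defs.v *)
From mathcomp Require Import all_boot all_order all_algebra.
From mathcomp Require Import boolp classical_sets reals.

Set Implicit Arguments.
Unset Strict Implicit.
Unset Printing Implicit Defensive.

Import Order.TTheory GRing.Theory Num.Theory.

Local Open Scope ring_scope.

Definition nat_minimum (A : set nat) (m : nat) : Prop :=
  A m /\ (forall a : nat, A a -> (m <= a)%N).

Section Codes.
Variables (F : finFieldType) (n : nat).

Definition hamming_dist (x y : 'rV[F]_n) : nat :=
  #|[set j : 'I_n | x 0 j != y 0 j]|.

Definition code_distances (C : {vspace 'rV[F]_n}) : set nat :=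
  fun d => exists x y : 'rV[F]_n,
    [/\ x \in C, y \in C, x != y & hamming_dist x y = d].

(* C is an [n, k, d]_q code, where q = #|F|. *)
Definition is_code (k d : nat) (C : {vspace 'rV[F]_n}) : Prop :=
  \dim C = k /\ nat_minimum (code_distances C) d.

Definition is_MDS_code (k d : nat) (C : {vspace 'rV[F]_n}) : Prop :=
  is_code k d C /\ (d + k = n + 1)%N.

Definition generator_matrix (k : nat) (G : 'M[F]_(k, n))
    (C : {vspace 'rV[F]_n}) : Prop :=
  basis_of C [seq row i G | i : 'I_k].

End Codes.

(* m(2, q) is the largest size of an arc in PG(2, q), equivalently the largest
   length of a 3-dimensional MDS code over F_q; for a prime power q >= 4 (the
   only case of interest here) it is given by this formula (Bose). *)
Definition m2 (q : nat) : nat := if odd q then q.+1 else q.+2.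

Section Recovery.
Variables (F : finFieldType) (k n : nat) (G : 'M[F]_(k, n)).

Definition std_vec (i : 'I_k) : 'cV[F]_k := delta_mx i 0.

Definition recovery_set (i : 'I_k) (J : {set 'I_n}) : bool :=
  std_vec i \in <<[seq col j G | j in J]>>%VS.

Definition minimal_recovery (i : 'I_k) : {set {set 'I_n}} :=
  [set J | minset (recovery_set i) J].

Definition minimal_recovery_sizes : set nat :=
  fun s => exists (i : 'I_k) (J : {set 'I_n}),
    J \in minimal_recovery i /\ #|J| = s.

(* An allocation is only meaningful at (i, J) with J \in minimal_recovery i:
   its other values are ignored. *)
Definition feasible_allocation (R : realType) (lam : 'rV[R]_k)
    (a : 'I_k -> {set 'I_n} -> R) : Prop :=
  [/\ forall (i : 'I_k) (J : {set 'I_n}),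
        J \in minimal_recovery i -> 0 <= a i J,
      forall i : 'I_k, \sum_(J in minimal_recovery i) a i J = lam 0 i
    & forall j : 'I_n,
        \sum_(i < k) \sum_(J in minimal_recovery i | j \in J) a i J <= 1].

Definition service_rate_region (R : realType) : set 'rV[R]_k :=
  fun lam => exists a : 'I_k -> {set 'I_n} -> R, feasible_allocation lam a.

End Recovery.

Definition std_simplex (R : realType) (k : nat) (s : R) : set 'rV[R]_k :=
  fun lam => (forall i : 'I_k, 0 <= lam 0 i) /\ \sum_(i < k) lam 0 i <= s.

Arguments service_rate_region {F k n} G R.
Arguments std_simplex {R} k s.

(* Main.v *)
Require Import Defs.
From mathcomp Require Import all_boot all_order all_algebra.
From mathcomp Require Import boolp classical_sets reals.

(** Every recovery set has at least two elements, so serving a total demand [s]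
    uses at least [2 s] of the total capacity [n]; hence the region lies in the
    simplex of size [n / 2]. Conversely, spread the demand for each object
    evenly over its [n / 2] recovery pairs: each server lies in exactly one pair
    per object and so receives the load [(2 / n) * s <= 1]. *)

Import Order.TTheory GRing.Theory Num.Theory.
Local Open Scope ring_scope.

Section ServiceRate.
Variables (R : realType) (F : finFieldType) (k n : nat) (G : 'M[F]_(k, n)).
Implicit Types (lam : 'rV[R]_k) (a : 'I_k -> {set 'I_n} -> R).

(** Double counting: a set [J] is charged [a i J] once at each of its [#|J|] servers. *)
Lemma total_load a :
  \sum_(j < n) \sum_(i < k) \sum_(J in minimal_recovery G i | j \in J) a i J =
  \sum_(i < k) \sum_(J in minimal_recovery G i) #|J|%:R * a i J.
Proof.
rewrite exchange_big /=; apply: eq_bigr => i _.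
rewrite (exchange_big_dep (mem (minimal_recovery G i))) /=; last first.
  by move=> j J _ /andP[].
apply: eq_bigr => J JG; rewrite JG /=.
by rewrite sumr_const mulr_natl.
Qed.

Lemma region_sub_simplex (d : nat) lam :
  (0 < d)%N ->
  (forall i (J : {set 'I_n}), J \in minimal_recovery G i -> (d <= #|J|)%N) ->
  service_rate_region G R lam -> std_simplex k (n%:R / d%:R) lam.
Proof.
move=> d_gt0 le_d [a [a_ge0 a_sum a_le1]]; split=> [i|].
  by rewrite -a_sum; apply: sumr_ge0 => J; apply: a_ge0.
rewrite ler_pdivlMr ?ltr0n // mulr_suml.
(* Adding up the [n] capacity constraints bounds the total load by [n]. *)
have le_n : \sum_(j < n) \sum_(i < k)
    \sum_(J in minimal_recovery G i | j \in J) a i J <= n%:R.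
  apply: le_trans (ler_sum _ (fun j _ => a_le1 j)) _.
  by rewrite sumr_const card_ord.
apply: le_trans le_n; rewrite total_load; apply: ler_sum => i _.
rewrite -a_sum mulr_suml; apply: ler_sum => J JG.
by rewrite mulrC ler_wpM2r ?a_ge0 ?ler_nat ?(le_d i).
Qed.

(** When the recovery sets of size [d] partition the servers there are [n / d] of them, so [d / n]
    is the equal share of each. *)
Definition uniform_allocation (d : nat) lam (i : 'I_k) (J : {set 'I_n}) : R :=
  if #|J| == d then lam 0 i * (d%:R / n%:R) else 0.

Lemma uniform_allocation_feasible (d : nat) lam :
  (0 < d)%N -> (0 < n)%N ->
  (forall i : 'I_k, finset.partition
     [set J in minimal_recovery G i | #|J| == d] [set: 'I_n]) ->
  std_simplex k (n%:R / d%:R) lam ->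
  feasible_allocation G lam (uniform_allocation d lam).
Proof.
move=> d_gt0 n_gt0 part_d [lam_ge0 lam_le].
have n_neq0 : n%:R != 0 :> R by rewrite pnatr_eq0 -lt0n.
split=> [i J _|i|j].
- by rewrite /uniform_allocation; case: ifP; rewrite // mulr_ge0 ?divr_ge0.
- rewrite /uniform_allocation -big_mkcondr /= sumr_const -[LHS]mulr_natr -mulrA.
  (* All blocks have size [d], so [n] is [d] times their number and the shares add up to
     [lam 0 i]. *)
  have /(card_uniform_partition (n := d)) := part_d i.
  rewrite cardsT card_ord => card_n.
  have {card_n} : n = (#|[set J in minimal_recovery G i | #|J| == d]| * d)%N.
    by apply: card_n => J; rewrite inE => /andP[_ /eqP].
  rewrite cardsE => /(congr1 (fun m => m%:R : R)); rewrite natrM => card_n.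
  by rewrite mulrAC -[d%:R * _]mulrC -card_n divff // mulr1.
(* Only the block through [j] contributes: another set containing [j] is not of size [d], hence gets
   0. *)
- have load i : \sum_(J in minimal_recovery G i | j \in J)
      uniform_allocation d lam i J = lam 0 i * (d%:R / n%:R).
    have /and3P[/eqP cov triv _] := part_d i.
    set P := [set J in _ | _] in cov triv.
    have jP : j \in finset.cover P by rewrite cov inE.
    have := pblock_mem jP; rewrite inE => /andP[BG Bd].
    rewrite (bigD1 (finset.pblock P j)) /=; last by rewrite BG finset.mem_pblock.
    rewrite {1}/uniform_allocation Bd big1 ?addr0 // => J.
    case/andP=> /andP[JG jJ]; rewrite /uniform_allocation.
    case: ifP => // Jd; case/eqP.
    by apply/esym/finset.def_pblock; rewrite // inE JG.
  (* The load at [j] is [d / n] times the total demand, and the simplex bounds that demand by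
     [n / d]. *)
  rewrite (eq_bigr _ (fun i _ => load i)) -mulr_suml.
  rewrite mulrA ler_pdivrMr ?ltr0n // mul1r.
  by rewrite -ler_pdivlMr ?ltr0n.
Qed.

End ServiceRate.

(** The support condition includes [lam 0 i <> 0] because a zero demand forces every nonnegative
    [a i J] in its sum to vanish, even on pairs. *)
Theorem theorem13 (R : realType) (F : finFieldType) (q n : nat)
    (hF : #|F| = q) (hq : (4 <= q)%N) (hn : n = m2 q)
    (C : {vspace 'rV[F]_n}) (hC : is_MDS_code 3 (n - 2) C)
    (G : 'M[F]_(3, n)) (hG : generator_matrix G C)
    (h1 : nat_minimum (minimal_recovery_sizes G) 2)
    (h2 : forall i : 'I_3,
        finset.partition [set J in minimal_recovery G i | #|J| == 2%N] [set: 'I_n]) :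
  service_rate_region G R = std_simplex 3 (n%:R / 2) /\
  (forall lam : 'rV[R]_3, service_rate_region G R lam ->
     exists a : 'I_3 -> {set 'I_n} -> R,
       feasible_allocation G lam a /\
       (forall (i : 'I_3) (J : {set 'I_n}), J \in minimal_recovery G i ->
          (a i J <> 0 <-> #|J| = 2%N /\ lam 0 i <> 0))).
Proof.
have n_gt0 : (0 < n)%N by rewrite hn /m2; case: ifP.
have sub lam : service_rate_region G R lam -> std_simplex 3 (n%:R / 2) lam.
  by apply: region_sub_simplex => // i J JG; apply: h1.2; exists i, J.
have feas lam : std_simplex 3 (n%:R / 2) lam ->
    feasible_allocation G lam (uniform_allocation R 3 n 2 lam).
  exact: uniform_allocation_feasible.
split=> [|lam /sub /feas lam_feas].
  apply/seteqP; split=> lam; first exact: sub.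
  by move/feas => lam_feas; exists (uniform_allocation R 3 n 2 lam).
exists (uniform_allocation R 3 n 2 lam); split=> // i J _.
(* As the share [2 / n] is nonzero, the value on a pair vanishes exactly when [lam 0 i] does. *)
have c_neq0 : 2 / n%:R != 0 :> R by rewrite mulf_neq0 ?invr_eq0 ?pnatr_eq0 -?lt0n.
rewrite /uniform_allocation; case: eqP => [J2|J2]; last by split=> // -[].
split=> [|[_ /eqP lam_neq0]]; last by apply/eqP; rewrite mulf_neq0.
by move=> nz; split=> // lam0; apply: nz; rewrite lam0 mul0r.
Qed.
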